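(* Let $n \ge 1$ be an integer, let $p \ge 2$, $\sigma > 0$, $\nu \in [0,1]$ with $\nu < p-1$, and $H_\nu > 0$ be real numbers, and let $T$ be an integer with $1 \le T \le n$. For every $T$-step first-order algorithm on $\mathbb{R}^n$ there exists a convex differentiable function $f:\mathbb{R}^n\to\mathbb{R}$ whose gradient is Hölder continuous of degree $\nu$ with constant $H_\nu$, i.e. $$\|\nabla f(x)-\nabla f(y)\| \le H_\nu \|x-y\|^\nu \qquad \text{for all } x,y\in\mathbb{R}^n,$$ such that, for the problem $$\min_{x\in\mathbb{R}^n}\Bigl\{F(x) := f(x)+\frac{\sigma}{p}\|x\|^p\Bigr\}$$ with optimal value $F^*$ and solution $x^*$, the $T$-th point $x_T$ generated by the algorithm using the first-order oracle of $f$ satisfies $$F(x_T)-F^* \;\ge\; \Bigl(\frac{p-1}{p}\Bigr)^{\frac{(p-1)(1+\nu)}{p-1-\nu}}\Bigl(\frac12\Bigr)^{\frac{(2p-1)(1+\nu)}{p-1-\nu}}\cdot\left(\frac{H_\nu}{\sigma^{\frac{1+\nu}{p}}\,T^{\frac{1+3\nu}{2}}}\right)^{\frac{p}{p-1-\nu}},$$ and the size of the solution is bounded as $$\|x^*\| \;\le\; \bigl(3(p-1)2^{p-3}\bigr)^{\frac1p}\cdot\left(\frac12\Bigl(\frac{p-1}{4p}\Bigr)^{\nu}\right)^{\frac{1}{p-1-\nu}}\left(\frac{H_\nu}{\sigma\, T^{\frac{1+3\nu}{2}}}\right)^{\frac{1}{p-1-\nu}}.$$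
   Context: Here $\|x\| = \bigl(\sum_{i=1}^n (x^{(i)})^2\bigr)^{1/2}$ is the standard Euclidean norm on $\mathbb{R}^n$. First-order local oracle: for a differentiable $f:\mathbb{R}^n\to\mathbb{R}$ and $x\in\mathbb{R}^n$, the oracle returns $\mathcal{I}(x)=\{f(x),\nabla f(x)\}$. Algorithm: a (deterministic) first-order algorithm is a sequence of mappings $\mathcal{A}=(A_0,A_1,A_2,\dots)$. It generates points in $\mathbb{R}^n$ by $x_1 := A_0(\varnothing)$ (a fixed point not depending on $f$) and $x_{k+1} := A_k(\mathcal{I}(x_1),\dots,\mathcal{I}(x_k))$ for $k\ge 1$. The mappings are arbitrary; the parameters of the regularizer ($\sigma$, $p$ and the norm) are directly available to the method, i.e. the mappings may depend on them. A $T$-step algorithm is one that generates the points $x_1,\dots,x_T$, i.e. it is given by the mappings $A_0,\dots,A_{T-1}$. The function $f$ may depend on the algorithm and on all the parameters. $F^* = \min_{x\in\mathbb{R}^n} F(x)$ and $x^*$ is the minimizer of $F$. *)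

(* Defs.v *)
From HB Require Import structures.
From mathcomp Require Import all_boot all_order all_algebra.
From mathcomp Require Import all_classical all_reals all_analysis.

Set Implicit Arguments.
Unset Strict Implicit.
Unset Printing Implicit Defensive.

Import Order.TTheory GRing.Theory Num.Theory.
Import numFieldNormedType.Exports.

Local Open Scope ring_scope.

(* The library norm on 'rV[R]_n is the max norm, hence this separate
   definition; the two norms induce the same notion of differentiability. *)
Definition enorm (R : realType) (n : nat) (x : 'rV[R]_n) : R :=
  Num.sqrt (\sum_(i < n) x 0 i ^+ 2).

Definition gradient (R : realType) (n : nat) (f : 'rV[R]_n -> R^o)
    (x : 'rV[R]_n) : 'rV[R]_n :=
  \row_(i < n) 'D_(delta_mx 0 i) f x.

Definition local_info (R : realType) (n : nat) : Type := (R * 'rV[R]_n)%type.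

Definition oracle (R : realType) (n : nat) (f : 'rV[R]_n -> R^o)
    (x : 'rV[R]_n) : local_info R n :=
  (f x, gradient f x).

(* A k is the mapping that receives the first k oracle answers, in
   chronological order; A 0 gets the empty tuple, i.e., is a fixed point. *)
Definition algorithm (R : realType) (n : nat) : Type :=
  forall k : nat, k.-tuple (local_info R n) -> 'rV[R]_n.

Fixpoint transcript (R : realType) (n : nat) (A : algorithm R n)
    (f : 'rV[R]_n -> R^o) (k : nat) : k.-tuple (local_info R n) :=
  if k is j.+1 return k.-tuple (local_info R n) then
    [tuple of rcons (transcript A f j) (oracle f (A j (transcript A f j)))]
  else [tuple].

(* The iterates are numbered from 1: iterate A f k is x_k for 1 <= k, and
   only uses the mappings A 0, ..., A (k - 1). *)
Definition iterate (R : realType) (n : nat) (A : algorithm R n)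
    (f : 'rV[R]_n -> R^o) (k : nat) : 'rV[R]_n :=
  A k.-1 (transcript A f k.-1).

Definition holder_gradient (R : realType) (n : nat) (nu H : R)
    (f : 'rV[R]_n -> R^o) : Prop :=
  forall x y : 'rV[R]_n,
    enorm (gradient f x - gradient f y) <= H * enorm (x - y) `^ nu.

Definition regularized (R : realType) (n : nat) (sigma p : R)
    (f : 'rV[R]_n -> R^o) (x : 'rV[R]_n) : R :=
  f x + sigma / p * enorm x `^ p.

Definition minimizer (R : realType) (n : nat) (F : 'rV[R]_n -> R)
    (x : 'rV[R]_n) : Prop :=
  forall y : 'rV[R]_n, F x <= F y.

(* Main.v *)
Require Import Defs.
From HB Require Import structures.
From mathcomp Require Import all_boot all_order all_algebra.
From mathcomp Require Import all_classical all_reals all_analysis.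
From mathcomp Require Import ring lra.


Set Implicit Arguments.
Unset Strict Implicit.
Unset Printing Implicit Defensive.

Import Order.TTheory GRing.Theory Num.Theory.
Import numFieldNormedType.Exports.

Local Open Scope ring_scope.

(** The hard functions have the form [beta * max_i (<d_i, x> - i mu)],
    smoothed, where [d_0, ..., d_(T-1)] are signed basis vectors chosen against
    the algorithm.

    Smoothing.  The maximum of [z] is replaced by its Moreau envelope, the
    maximum over the simplex of [<l, z> - mu/2 |l|^2].  The maximizer, which is
    the gradient, depends on [z] in a [1/mu]-Lipschitz way and has diameter at
    most [2]; interpolating the two bounds gives a Hoelder gradient of every
    degree [nu <= 1], with constant [2 beta mu^(-nu)] ([hard_holder]).  A piece
    that lies [mu] below the largest one gets weight zero, so it is invisible to
    the oracle ([oracle_prefix]).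

    Resistance.  When the algorithm makes its [j]-th query, the direction [d_j]
    is taken to be the unused signed coordinate on which the query is largest.
    All later directions are then dominated at that point by [d_j], and the
    shifts [i mu] turn the domination into a gap of at least [mu].  Hence the
    answers do not depend on directions that are not yet chosen, the final
    function is consistent with the whole transcript, and at the last query
    [<d_(T-1), x_T> >= 0], so that [f x_T >= - beta T mu]
    ([resisting_directions], [iterate_take], [hard_ge_last]).

    Balance.  The minimum of [- beta r / sqrt T + sigma/p r^p] is reached at the
    [r = s] such that [beta = sigma s^(p-1) sqrt T], with value
    [- (p-1)/p sigma s^p]; this is also an upper bound of the optimal value,
    through the point [- s / sqrt T * sum_i d_i].  With
    [T mu = (p-1)/(4p) * s / sqrt T] the smoothing and the shifts cost at most a
    quarter of that, and [beta = 1/2 H mu^nu] is what the Hoelder constant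
    allows; these equations determine [s], [mu] and [beta], and the stated
    residual is exactly [(p-1)/(2p) sigma s^p] ([residual_constantE]).

    Norm of the solution.  Averaging the pieces bounds the objective below in
    terms of the norm only, and the same value is almost reached at the point of
    norm close to [s] where all pieces are equal.  So [r = |x*| / s] satisfies
    [r^p - p r <= v - p] with [v] close to [1], which [radius_bound] solves. *)

(** * Euclidean geometry of row vectors *)

Section Euclidean.
Variables (R : realType) (n : nat).
Implicit Types u v w x y : 'rV[R]_n.

Definition dot u v : R := \sum_(i < n) u 0 i * v 0 i.

Lemma dotC u v : dot u v = dot v u.
Proof. by apply: eq_bigr => i _; rewrite mulrC. Qed.

Lemma dotDr u v w : dot u (v + w) = dot u v + dot u w.
Proof. by rewrite -big_split; apply: eq_bigr => i _; rewrite mxE mulrDr. Qed.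

Lemma dotZr a u v : dot u (a *: v) = a * dot u v.
Proof. by rewrite mulr_sumr; apply: eq_bigr => i _; rewrite mxE mulrCA. Qed.

Lemma dotNr u v : dot u (- v) = - dot u v.
Proof. by rewrite -scaleN1r dotZr mulN1r. Qed.

Lemma dotBr u v w : dot u (v - w) = dot u v - dot u w.
Proof. by rewrite dotDr dotNr. Qed.

Lemma dot0r u : dot u 0 = 0.
Proof. by rewrite -(scale0r 0) dotZr mul0r. Qed.

Lemma dot_sumr (I : Type) (r : seq I) u (F : I -> 'rV[R]_n) :
  dot u (\sum_(i <- r) F i) = \sum_(i <- r) dot u (F i).
Proof.
by elim/big_rec2: _ => [|i _ y _ <-]; [exact: dot0r|rewrite dotDr].
Qed.

Lemma dotDl u v w : dot (v + w) u = dot v u + dot w u.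
Proof. by rewrite dotC dotDr !(dotC u). Qed.

Lemma dotZl a u v : dot (a *: v) u = a * dot v u.
Proof. by rewrite dotC dotZr dotC. Qed.

Lemma dotBl u v w : dot (v - w) u = dot v u - dot w u.
Proof. by rewrite dotC dotBr !(dotC u). Qed.

Lemma dot_suml (I : Type) (r : seq I) u (F : I -> 'rV[R]_n) :
  dot (\sum_(i <- r) F i) u = \sum_(i <- r) dot (F i) u.
Proof. by rewrite dotC dot_sumr; apply: eq_bigr => i _; rewrite dotC. Qed.

Lemma dot_delta (i : 'I_n) x : dot (delta_mx 0 i) x = x 0 i.
Proof.
rewrite /dot (bigD1 i) //= big1 ?addr0 => [|j /negPf jN]; rewrite mxE eqxx /=.
  by rewrite eqxx mul1r.
by rewrite jN mul0r.
Qed.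

Lemma dot_ge0 x : 0 <= dot x x.
Proof. by apply: sumr_ge0 => i _; rewrite -expr2 sqr_ge0. Qed.

Lemma dot_eq0 x : (dot x x == 0) = (x == 0).
Proof.
apply/idP/eqP => [/eqP x0|->]; last by rewrite dot0r.
apply/rowP => i; rewrite mxE; apply/eqP; rewrite -sqrf_eq0 expr2.
by rewrite (psumr_eq0P _ x0) // => j _; rewrite -expr2 sqr_ge0.
Qed.

Lemma enormE x : enorm x = Num.sqrt (dot x x).
Proof. by rewrite /enorm /dot; under eq_bigr do rewrite expr2. Qed.

Lemma sqr_enorm x : enorm x ^+ 2 = dot x x.
Proof. by rewrite enormE sqr_sqrtr ?dot_ge0. Qed.

Lemma enorm_ge0 x : 0 <= enorm x.
Proof. exact: sqrtr_ge0. Qed.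

Lemma enorm0 : enorm (0 : 'rV[R]_n) = 0.
Proof. by rewrite enormE dot0r sqrtr0. Qed.

Lemma enormZ a x : enorm (a *: x) = `|a| * enorm x.
Proof.
by rewrite !enormE dotZl dotZr mulrA -expr2 sqrtrM ?sqr_ge0 // sqrtr_sqr.
Qed.

Lemma enormN x : enorm (- x) = enorm x.
Proof. by rewrite -scaleN1r enormZ normrN1 mul1r. Qed.

Lemma Cauchy_Schwarz u v : dot u v <= enorm u * enorm v.
Proof.
have [->|u0] := eqVneq u 0; first by rewrite dotC dot0r enorm0 mul0r.
have [->|v0] := eqVneq v 0; first by rewrite dot0r enorm0 mulr0.
have pos x : x != 0 -> 0 < enorm x.
  by move=> x0; rewrite enormE sqrtr_gt0 lt_neqAle dot_ge0 eq_sym dot_eq0 x0.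
have up := pos u u0; have vp := pos v v0.
have := dot_ge0 (enorm v *: u - enorm u *: v).
rewrite dotBl !dotBr !dotZl !dotZr (dotC v u) -!sqr_enorm => h.
have : 0 <= (2 * enorm u * enorm v) * (enorm u * enorm v - dot u v).
  by apply: le_trans h _; rewrite le_eqVlt; apply/orP; left; apply/eqP; ring.
by rewrite pmulr_rge0 ?mulr_gt0 // subr_ge0.
Qed.

Lemma enorm_triangle u v : enorm (u + v) <= enorm u + enorm v.
Proof.
rewrite -(@ler_pXn2r _ 2) // ?nnegrE ?addr_ge0 ?enorm_ge0 //.
rewrite sqr_enorm dotDl !dotDr (dotC v u) -!sqr_enorm.
have := Cauchy_Schwarz u v; nra.
Qed.

Lemma enorm_lipschitz x y : `|enorm x - enorm y| <= enorm (x - y).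
Proof.
have := enorm_triangle (x - y) y; have := enorm_triangle (y - x) x.
rewrite !subrK -(enormN (x - y)) opprB ler_norml => h1 h2.
by apply/andP; split; lra.
Qed.

(** The topology of row vectors comes from the max norm; the next two bounds
    transfer smallness and boundedness between the two norms. *)
Lemma enorm_le_norm x : enorm x <= Num.sqrt n%:R * `|x|.
Proof.
rewrite enormE -[`|x|]ger0_norm // -sqrtr_sqr -sqrtrM ?ler0n // ler_wsqrtr //.
have -> : n%:R * `|x| ^+ 2 = \sum_(i < n) `|x| ^+ 2.
  by rewrite sumr_const card_ord mulr_natl.
apply: ler_sum => i _; rewrite -expr2 -real_normK ?num_real //.
rewrite ler_pXn2r ?nnegrE // [leRHS]/Num.Def.normr /= mx_normrE.
exact: (le_bigmax _ (fun ij : 'I_1 * 'I_n => `|x ij.1 ij.2|) (0, i)).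
Qed.

Lemma norm_le_enorm x : `|x| <= enorm x.
Proof.
rewrite /Num.Def.normr /= mx_normrE; apply/bigmax_leP; split=> [|[i j] _ /=].
  exact: enorm_ge0.
rewrite -sqrtr_sqr enormE ler_wsqrtr // ord1 /dot (bigD1 j) //= -expr2 lerDl.
by apply: sumr_ge0 => k _; rewrite -expr2 sqr_ge0.
Qed.

End Euclidean.

(** * Inequalities for real powers *)

Section PowR.
Variable R : realType.
Implicit Types p r u v : R.

(** Young's inequality, read as: the graph of the power function lies above
    its tangent line at [u]. *)
Lemma powR_tangent p r u : 1 <= p -> 0 <= r -> 0 <= u ->
  p * r * u `^ (p - 1) <= r `^ p + (p - 1) * u `^ p.
Proof.
rewrite le_eqVlt => /predU1P[<-|p1] r0 u0.
  by rewrite subrr powRr0 !powRr1 // mul1r mul0r addr0 mulr1.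
have p0 : 0 < p by apply: lt_trans p1.
have p10 : 0 < p - 1 by rewrite subr_gt0.
have := @conjugate_powR _ r (u `^ (p - 1)) p (p / (p - 1)) r0 (powR_ge0 _ _) p0.
rewrite divr_gt0 // -powRrM mulrCA divff ?gt_eqF // mulr1 => /(_ isT).
have -> : p^-1 + (p / (p - 1))^-1 = 1 by field; rewrite !gt_eqF.
move=> /(_ erefl) h; rewrite -mulrA -ler_pdivlMl //.
apply: le_trans h _; rewrite le_eqVlt; apply/orP; left; apply/eqP; field.
by rewrite !gt_eqF.
Qed.

(** The sum of the tangent inequalities at the midpoint. *)
Lemma powR_midpoint p r u : 1 <= p -> 0 <= r -> 0 <= u ->
  ((r + u) / 2) `^ p <= (r `^ p + u `^ p) / 2.
Proof.
move=> p1 r0 u0; have p0 : 0 < p by apply: lt_le_trans p1.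
have m0 : 0 <= (r + u) / 2 by rewrite divr_ge0 ?addr_ge0.
have := powR_tangent p1 r0 m0; have := powR_tangent p1 u0 m0.
have := mulr_powRB1 m0 p0.
move: (_ `^ (p - 1)) (_ `^ p) (r `^ p) (u `^ p) => a b c d e h1 h2; nra.
Qed.

Lemma powR_sub_le p r u : 1 <= p -> 0 <= r -> 0 <= u ->
  r `^ p - u `^ p <= p * r `^ (p - 1) * (r - u).
Proof.
move=> p1 r0 u0; have := powR_tangent p1 u0 r0.
have := mulr_powRB1 r0 (lt_le_trans ltr01 p1).
move: (_ `^ (p - 1)) (r `^ p) (u `^ p) => a b c e h; nra.
Qed.

(** Used for the continuity of [enorm x `^ p], including at the origin: there
    [r |-> r `^ p] is not continuous from the left, being [1] for [r < 0]. *)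
Lemma powR_lipschitz p r u M : 1 <= p -> 0 <= r <= M -> 0 <= u <= M ->
  `|r `^ p - u `^ p| <= p * M `^ (p - 1) * `|r - u|.
Proof.
wlog ur : r u / u <= r => [hw p1 rM uM|].
  have [/hw|/ltW/hw] := leP u r; first exact.
  by rewrite distrC (distrC r); apply.
move=> p1 /andP[r0 rM] /andP[u0 uM].
have p0 : 0 <= p by apply: le_trans p1.
rewrite !ger0_norm ?subr_ge0 //; last by apply: ge0_ler_powR.
apply: le_trans (powR_sub_le p1 r0 u0) _.
rewrite ler_wpM2r ?subr_ge0 // ler_wpM2l // ge0_ler_powR ?subr_ge0 //.
exact: le_trans rM.
Qed.

Lemma powR_sqr p r : 0 <= r -> r `^ p = (r ^+ 2) `^ (p / 2).
Proof.
by move=> r0; rewrite -(powR_mulrn 2 r0) -powRrM mulrCA mulfV ?mulr1 //.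
Qed.

(** The tangent inequality at [5/4] trades the linear term for a fixed fraction
    of [r `^ p].  The bound on [v] is the one that [powR_half_sub1_le] gives for
    [v = (1 + e) `^ (p / 2)] with [e = ((p - 1) / p) ^+ 2 / 16]. *)
Lemma radius_bound p r v : 2 <= p -> 0 <= r ->
  r `^ p - p * r <= v - p ->
  v - 1 <= (p - 1) * 2 `^ (p - 2) / 32 ->
  r `^ p <= 3 * (p - 1) * 2 `^ (p - 3).
Proof.
move=> p2 r0 hr hv.
have p1 : 1 <= p by lra.
have u0 : (0 : R) < 5 / 4 by lra.
have tan := powR_tangent p1 r0 (ltW u0).
have uE := mulr_powRB1 (ltW u0) (lt_le_trans ltr01 p1).
have u1 : 5 / 4 <= (5 / 4 : R) `^ (p - 1) by rewrite le1r_powR; lra.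
have two1 : 1 <= (2 : R) `^ (p - 2).
  have : (2 : R) `^ 0 <= 2 `^ (p - 2) by rewrite ler_powR ?subr_ge0 ?ler1n.
  by rewrite powRr0.
have -> : (2 : R) `^ (p - 3) = 2 `^ (p - 2) / 2.
  have -> : p - 3 = (p - 2) - 1 by ring.
  by rewrite powRB ?powRr1 // pnatr_eq0 implybT.
rewrite -uE in tan.
move: (2 `^ (p - 2)) ((5 / 4) `^ (p - 1)) u1 two1 tan hv {uE}.
move=> w c c1 w1 tan hv.
have rp0 : 0 <= r `^ p by apply: powR_ge0.
move: (r `^ p) rp0 tan hr => X X0 tan hr.
have c0 : 0 < c by lra.
have : p * r <= X * (4 / 5) + (p - 1) * (5 / 4).
  rewrite -(ler_pM2r c0); apply: le_trans tan _.
  by nra.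
nra.
Qed.

Lemma powR_half_sub1_le p e : 2 <= p -> 0 <= e <= 1 ->
  (1 + e) `^ (p / 2) - 1 <= p / 2 * e * 2 `^ (p - 2).
Proof.
move=> p2 /andP[e0 e1]; have m1 : 1 <= p / 2 by lra.
have v0 : 0 <= 1 + e by lra.
have := powR_sub_le m1 v0 ler01; rewrite powR1 => /le_trans; apply.
rewrite (addrC 1 e) addrK mulrAC ler_wpM2l ?mulr_ge0 //; first lra.
apply: (@le_trans _ _ (2 `^ (p / 2 - 1))).
  by apply: ge0_ler_powR; rewrite ?nnegrE; lra.
by rewrite ler_powR ?ler1n //; lra.
Qed.

End PowR.

(** * Differentiability and minimizers *)

Section Calculus.
Variables (R : realType) (n : nat).
Implicit Types (x y g h : 'rV[R]_n) (f : 'rV[R]_n -> R^o).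

(** [dot g] with codomain [R^o], the shape in which differentials are stated. *)
Definition dot_form g : 'rV[R]_n -> R^o := dot g.

Fact dot_form_linear g : linear (dot_form g).
Proof. by move=> a u v; rewrite /dot_form dotDr dotZr. Qed.

HB.instance Definition _ g :=
  GRing.isLinear.Build _ _ _ _ (dot_form g) (dot_form_linear g).

Lemma enorm_lipschitz_continuous (f : 'rV[R]_n -> R) L :
  (forall x y, `|f x - f y| <= L * enorm (x - y)) -> continuous f.
Proof.
move=> fL x; apply/(@cvgrPdist_le _ _ _ (nbhs x)) => e e0.
(* The extra 1 keeps K positive when L or n vanishes. *)
pose K := `|L| * Num.sqrt n%:R + 1.
have K0 : 0 < K by rewrite ltr_wpDl ?mulr_ge0 ?sqrtr_ge0.
near=> y; apply: le_trans (fL x y) _.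
have xyK : `|x - y| <= e / K.
  by near: y; apply: cvgr_dist_le; rewrite ?divr_gt0.
rewrite ler_pdivlMr // mulrC in xyK; apply: le_trans xyK.
apply: (@le_trans _ _ (`|L| * enorm (x - y))).
  by rewrite ler_wpM2r ?enorm_ge0 ?ler_norm.
apply: (@le_trans _ _ (`|L| * (Num.sqrt n%:R * `|x - y|))).
  by rewrite ler_wpM2l ?enorm_le_norm.
by rewrite mulrA /K mulrDl lerDl mul1r.
Unshelve. all: by end_near. Qed.

Lemma enorm_continuous : continuous (@enorm R n).
Proof.
apply: (@enorm_lipschitz_continuous _ 1) => x y.
by rewrite mul1r enorm_lipschitz.
Qed.

Lemma dot_form_continuous g : continuous (dot_form g).
Proof.
apply: (@enorm_lipschitz_continuous _ (enorm g)) => x y.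
rewrite ler_norml -dotBr Cauchy_Schwarz andbT lerNl -dotNr.
by rewrite -(enormN (x - y)) Cauchy_Schwarz.
Qed.

Lemma powR_enorm_continuous p : 1 <= p ->
  continuous (fun x : 'rV[R]_n => enorm x `^ p).
Proof.
move=> p1 x; apply/(@cvgrPdist_le _ _ _ (nbhs x)) => e e0.
pose M := enorm x + 1; pose K := p * M `^ (p - 1) + 1.
have p0 : 0 <= p by apply: le_trans p1.
have K0 : 0 < K by rewrite ltr_wpDl ?mulr_ge0 ?powR_ge0.
near=> y.
have xy1 : `|enorm x - enorm y| <= 1.
  by near: y; apply: (cvgr_dist_le _ _ (@enorm_continuous x)).
have xyK : `|enorm x - enorm y| <= e / K.
  by near: y; apply: (cvgr_dist_le _ _ (@enorm_continuous x)); rewrite divr_gt0.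
rewrite ler_pdivlMr // mulrC in xyK; apply: le_trans xyK.
apply: le_trans (_ : _ <= p * M `^ (p - 1) * _) _.
  apply: powR_lipschitz => //; rewrite enorm_ge0 /M /= ?lerDl //.
  by move: xy1; rewrite ler_norml => /andP[]; lra.
by rewrite /K mulrDl lerDl mul1r.
Unshelve. all: by end_near. Qed.

(** Differentiability in the sense of the max norm follows from a Euclidean
    quadratic error bound, the two norms being equivalent. *)
Lemma quadratic_gap_differential f x g C :
  (forall h, `|f (x + h) - f x - dot g h| <= C * dot h h) ->
  differentiable f x /\ gradient f x = g.
Proof.
move=> gap.
have dfx : f \o shift x = cst (f x) + dot_form g +o_ (0 : 'rV[R]_n) id.
  apply/eqaddoP => e e0.
  pose K := `|C| * n%:R + 1.
  have K0 : 0 < K by rewrite ltr_wpDl ?mulr_ge0.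
  near=> h.
  have hK : `|h| <= e / K.
    near: h; apply: (@nbhs0_le _ 'rV[R]_n); exact: divr_gt0.
  have -> : (f \o shift x - (cst (f x) + dot_form g)) h =
            f (x + h) - f x - dot g h.
    by rewrite !fctE /= (addrC h) opprD addrA.
  apply: le_trans (gap h) _.
  apply: (@le_trans _ _ (`|C| * (n%:R * `|h| ^+ 2))).
    apply: (@le_trans _ _ (`|C| * dot h h)).
      by rewrite ler_wpM2r ?dot_ge0 ?ler_norm.
    rewrite ler_wpM2l // -sqr_enorm -[n%:R]sqr_sqrtr ?ler0n // -exprMn.
    by rewrite ler_pXn2r ?nnegrE ?enorm_ge0 ?mulr_ge0 ?sqrtr_ge0 ?enorm_le_norm.
  rewrite mulrA expr2 mulrA ler_wpM2r //.
  rewrite ler_pdivlMr // mulrC in hK; apply: le_trans hK.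
  by rewrite /K mulrDl lerDl mul1r.
have dE := diff_unique (@dot_form_continuous g) dfx.
have df : differentiable f x.
  by apply/diff_locallyP; rewrite dE; split=> //; exact: dot_form_continuous.
split=> //; apply/rowP => i; rewrite mxE deriveE // dE.
by apply: etrans (dot_delta i g); exact: dotC.
Unshelve. all: by end_near. Qed.

End Calculus.

Section Minimizer.
Variables (R : realType) (n : nat).
Implicit Types x y g : 'rV[R]_n.

Lemma parallelogram x y :
  dot (2^-1 *: (x + y)) (2^-1 *: (x + y)) =
  (dot x x + dot y y) / 2 - dot (x - y) (x - y) / 4.
Proof.
by rewrite dotZl dotZr dotBl !dotBr dotDl !dotDr (dotC y x); field.
Qed.

Lemma enorm_powR p x : enorm x `^ p = dot x x `^ (p / 2).
Proof. by rewrite enormE -powR12_sqrt ?dot_ge0 // -powRrM mulrC. Qed.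

(** Strictness comes from the parallelogram law for the square of the norm; the
    exponent [p / 2 >= 1] is then only monotone and convex. *)
Lemma powR_enorm_strict_midpoint p x y : 2 <= p -> x != y ->
  enorm (2^-1 *: (x + y)) `^ p < (enorm x `^ p + enorm y `^ p) / 2.
Proof.
move=> p2 xy; rewrite !enorm_powR.
have m1 : 1 <= p / 2 by lra.
apply: lt_le_trans (powR_midpoint m1 (dot_ge0 x) (dot_ge0 y)).
apply: gt0_ltr_powR; rewrite ?nnegrE ?dot_ge0 //; first lra.
  by rewrite divr_ge0 ?addr_ge0 ?dot_ge0.
rewrite parallelogram gtrBl divr_gt0 // lt_neqAle dot_ge0 eq_sym dot_eq0.
by rewrite subr_eq0 xy.
Qed.

(** The power term makes the sublevel set at the origin bounded, since the
    affine minorant is only of linear growth, and it makes [F] strictly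
    convex. *)
Lemma regularized_unique_minimizer sigma p (f : 'rV[R]_n -> R^o) g :
  0 < sigma -> 2 <= p -> continuous f ->
  (forall x, f 0 + dot g x <= f x) ->
  (forall x y, f (2^-1 *: (x + y)) <= (f x + f y) / 2) ->
  exists x, unique (minimizer (regularized sigma p f)) x.
Proof.
move=> s0 p2 fc fg fm; set F := regularized sigma p f.
have p0 : 0 < p by lra.
have sp0 : 0 < sigma / p by rewrite divr_gt0.
(* Beyond norm 1 the p-th power exceeds the square, and beyond the second term
   the square outweighs the linear part. *)
pose M := 1 + enorm g / (sigma / p).
have M1 : 1 <= M by rewrite lerDl divr_ge0 ?enorm_ge0 ?ltW.
have far x : M < enorm x -> F 0 < F x.
  move=> Mx; rewrite /F /regularized enorm0 powR0 ?gt_eqF // mulr0 addr0.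
  have x1 : 1 <= enorm x by rewrite (le_trans M1) ?ltW.
  have xp : enorm x ^+ 2 <= enorm x `^ p.
    by rewrite -powR_mulrn ?enorm_ge0 // ler_powR.
  have := Cauchy_Schwarz (- g) x; rewrite enormN dotC dotNr dotC => gx.
  apply: lt_le_trans (_ : f 0 + (dot g x + sigma / p * enorm x ^+ 2) <= _).
    rewrite ltrDl; move: Mx; rewrite /M -ltrBrDl ltr_pdivrMr // => Mx.
    rewrite -ltrBlDl sub0r; apply: le_lt_trans gx _.
    rewrite expr2 mulrA ltr_pM2r ?(lt_le_trans ltr01) //.
    by apply: lt_le_trans Mx _; rewrite mulrC ler_pM2l // gerBl.
  by rewrite addrA lerD ?fg // ler_pM2l.
pose B := [set x : 'rV[R]_n | enorm x <= M]%classic.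
have B0 : B 0 by rewrite /B /= enorm0 (le_trans ler01).
have Bc : compact B.
  apply: bounded_closed_compact.
    exists M; split; first exact: num_real.
    move=> b Mb x Bx; apply: le_trans (norm_le_enorm x) _.
    exact: le_trans Bx (ltW Mb).
  rewrite (_ : B = @enorm R n @^-1` [set r | r <= M])%classic //.
  apply: preimage_closed; last exact: closed_le.
  by move=> x _; exact: enorm_continuous.
have Fc : {within B, continuous F}%classic.
  apply: continuous_subspaceT => x.
  apply: (@continuousD _ R^o _ f _ x (fc x)).
  apply: (@continuousM _ _ (cst (sigma / p))); first exact: cst_continuous.
  by apply: powR_enorm_continuous; lra.
have [x _ xmin] := EVT_min_rV (ex_intro _ _ B0) Bc Fc.
have xm : minimizer F x.
  move=> y; have [yM|/far/ltW] := leP (enorm y) M.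
    by apply: xmin; rewrite inE.
  by apply: le_trans; apply: xmin; rewrite inE.
exists x; split=> // y ym; apply/eqP; apply/negP => /negP xy.
have := powR_enorm_strict_midpoint p2 xy; have := fm x y.
have := xm y; have := ym x; have := xm (2^-1 *: (x + y)).
rewrite /F /regularized -(ltr_pM2l sp0).
move: (_ `^ p) (_ `^ p) (_ `^ p) => a b c; nra.
Qed.

End Minimizer.

(** * The smoothed maximum *)

Section SmoothMax.
Variables (R : realType) (mu : R).
Hypothesis mu_gt0 : 0 < mu.
Implicit Types (z l : nat -> R) (t : R).

Definition excess k z t : R := \sum_(i < k) Num.max (z i - t) 0.

Lemma excess_continuous k z : continuous (excess k z).
Proof.
have cadd : continuous (fun x : R^o * R^o => x.1 + x.2).
  exact: add_continuous.
apply: (continuous_big cadd) => i _ t.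
apply: (@continuous_max _ _ (fun t => z i - t) (cst 0));
  last exact: cst_continuous.
by apply: continuousB; [exact: cst_continuous|exact: cvg_id].
Qed.

Lemma excess_level_exists k z : (0 < k)%N -> exists t, excess k z t = mu.
Proof.
move=> k0; pose b := \sum_(i < k) `|z i|; pose i0 := Ordinal k0.
have zb (i : 'I_k) : z i <= b.
  apply: le_trans (ler_norm _) _; rewrite /b (bigD1 i) //= lerDl.
  exact: sumr_ge0.
have ab : z i0 - mu <= b by apply: le_trans (zb i0); rewrite gerBl ltW.
have eb : excess k z b = 0.
  by apply: big1 => i _; apply/max_idPr; rewrite subr_le0.
have ea : mu <= excess k z (z i0 - mu).
  rewrite /excess (bigD1 i0) //= subKr (max_l (ltW mu_gt0)).
  rewrite lerDl sumr_ge0 // => i _.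
  by rewrite le_max lexx orbT.
have [||t _ <-] := @IVT _ (excess k z) (z i0 - mu) b mu ab; last by exists t.
  exact/continuous_subspaceT/excess_continuous.
by rewrite eb ge_min le_max ea (ltW mu_gt0) orbT.
Qed.

(** The threshold of the projection onto the simplex: the weights
    [max (z i - t) 0 / mu] sum to [1] exactly when the excess over [t] is [mu].
    The intermediate value theorem provides it. *)
Definition level k z : R := xget 0 [set t | excess k z t = mu]%classic.

Lemma levelP k z : (0 < k)%N -> excess k z (level k z) = mu.
Proof.
move=> k0; have [t tP] := excess_level_exists z k0.
exact: (@xgetPex _ 0 [set t | excess k z t = mu]%classic (ex_intro _ t tP)).
Qed.

Lemma excess_mono k z t t' : t < t' -> 0 < excess k z t' ->
  excess k z t' < excess k z t.
Proof.
move=> tt' e0.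
have mono (i : 'I_k) : Num.max (z i - t') 0 <= Num.max (z i - t) 0.
  by rewrite ge_max !le_max lexx orbT andbT lerB // ltW.
have [i zi] : exists i : 'I_k, t' < z i.
  apply/existsP; apply: contraTT e0 => /existsPn zt; rewrite -leNgt.
  by apply: sumr_le0 => i _; rewrite ge_max lexx andbT subr_le0 leNgt.
rewrite /excess (bigD1 i) //= [ltRHS](bigD1 i) //= ltr_leD //.
  rewrite !max_l ?subr_ge0 ?ltrD2l ?ltrN2 // ltW //; exact: lt_trans zi.
by apply: ler_sum => j _.
Qed.

Lemma level_unique k z t : (0 < k)%N -> excess k z t = mu -> level k z = t.
Proof.
move=> k0 tP; have lP := levelP z k0.
case: (ltgtP (level k z) t) => // /(@excess_mono k z); rewrite lP tP ltxx;
  by move=> /(_ mu_gt0).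
Qed.

Definition weight k z i : R := Num.max (z i - level k z) 0 / mu.

Definition smooth_max k z : R :=
  level k z + (\sum_(i < k) Num.max (z i - level k z) 0 ^+ 2) / (2 * mu).

Lemma weight_ge0 k z i : 0 <= weight k z i.
Proof. by rewrite divr_ge0 ?le_max ?lexx ?orbT ?ltW. Qed.

Lemma sum_weight k z : (0 < k)%N -> \sum_(i < k) weight k z i = 1.
Proof.
by move=> k0; rewrite -mulr_suml -/(excess k z _) levelP // divff ?gt_eqF.
Qed.

Lemma weight_le1 k z i : (i < k)%N -> weight k z i <= 1.
Proof.
move=> ik; rewrite -(sum_weight z (leq_ltn_trans (leq0n i) ik)).
rewrite (bigD1 (Ordinal ik)) //= lerDl sumr_ge0 // => j _.
exact: weight_ge0.
Qed.

(** [smooth_max] is the maximum of the strongly concave quadratic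
    [l |-> sum_i l_i z_i - mu/2 |l|^2] over the simplex, attained at the
    weights: [level] is the multiplier of the constraint [sum_i l_i = 1]. *)
Lemma smooth_max_ge k z l : (0 < k)%N ->
  (forall i, 0 <= l i) -> \sum_(i < k) l i = 1 ->
  \sum_(i < k) l i * z i - mu / 2 * \sum_(i < k) l i ^+ 2
    + mu / 2 * \sum_(i < k) (weight k z i - l i) ^+ 2 <= smooth_max k z.
Proof.
move=> k0 l0 l1; rewrite /smooth_max.
have lE : level k z = \sum_(i < k) l i * level k z.
  by rewrite -mulr_suml l1 mul1r.
rewrite [X in X + _ / _]lE -lerBlDl.
rewrite !mulr_suml !mulr_sumr -!sumrB -big_split -sumrB /=.
apply: ler_sum => i _; rewrite /weight.
set u := Num.max _ _; have := l0 i.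
have uz : z i - level k z <= u by rewrite /u le_max lexx.
move=> li; rewrite -subr_ge0.
rewrite [leRHS](_ : _ = l i * (u - (z i - level k z))).
  by rewrite mulr_ge0 // subr_ge0.
by field; rewrite gt_eqF.
Qed.

Lemma smooth_max_weight k z : (0 < k)%N ->
  smooth_max k z = \sum_(i < k) weight k z i * z i
    - mu / 2 * \sum_(i < k) weight k z i ^+ 2.
Proof.
move=> k0; rewrite /smooth_max.
have lE : level k z = \sum_(i < k) weight k z i * level k z.
  by rewrite -mulr_suml sum_weight // mul1r.
rewrite [X in X + _ / _]lE !mulr_suml mulr_sumr.
rewrite -sumrB -big_split /=; apply: eq_bigr => i _; rewrite /weight.
case: (leP (z i - level k z) 0) => h; field;
  by rewrite gt_eqF.
Qed.

(** Weights charge only the entries within [mu] of the maximum, so entries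
    lower than that can be dropped. *)
Lemma level_prefix k m z z' j : (j < k)%N -> (k <= m)%N ->
  (forall i, (i < k)%N -> z i = z' i) ->
  (forall i, (k <= i < m)%N -> z i <= z j - mu) ->
  level m z = level k z'.
Proof.
move=> jk km zz' low; have k0 := leq_ltn_trans (leq0n j) jk.
apply: level_unique; first exact: leq_trans km.
have zl : z j - mu <= level k z'.
  rewrite lerBlDl -lerBlDr zz' // -(levelP z' k0) /excess.
  rewrite (bigD1 (Ordinal jk)) //=.
  apply: le_trans (_ : _ <= Num.max (z' j - level k z') 0) _.
    by rewrite le_max lexx.
  by rewrite lerDl sumr_ge0 // => i _; rewrite le_max lexx orbT.
rewrite -[RHS](levelP z' k0) /excess -(subnKC km) big_split_ord /=.
rewrite [X in _ + X]big1 ?addr0 => [|i _].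
  by apply: eq_bigr => i _; rewrite zz'.
apply/max_idPr; rewrite subr_le0; apply: le_trans zl; apply: low.
by rewrite leq_addr /= -ltn_subRL.
Qed.

Section Prefix.
Variables (k m : nat) (z z' : nat -> R) (j : nat).
Hypotheses (jk : (j < k)%N) (km : (k <= m)%N)
  (zz' : forall i, (i < k)%N -> z i = z' i)
  (low : forall i, (k <= i < m)%N -> z i <= z j - mu).

Lemma weight_prefix i : (i < k)%N -> weight m z i = weight k z' i.
Proof. by move=> ik; rewrite /weight (level_prefix jk km zz' low) zz'. Qed.

Lemma weight_low i : (k <= i < m)%N -> weight m z i = 0.
Proof.
move=> /[dup] /low zi /andP[ki im].
have w1 : weight m z j <= 1 by rewrite weight_le1 // (leq_trans jk).
rewrite /weight max_r ?mul0r // subr_le0; apply: le_trans zi _.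
rewrite lerBlDl -lerBlDr; rewrite /weight ler_pdivrMr // mul1r in w1.
by apply: le_trans w1; rewrite le_max lexx.
Qed.

Lemma sum_weight_prefix (V : lmodType R) (F : nat -> V) :
  \sum_(i < m) weight m z i *: F i = \sum_(i < k) weight k z' i *: F i.
Proof.
rewrite -(subnKC km) big_split_ord /= subnKC //.
rewrite [X in _ + X]big1 ?addr0 => [|i _].
  by apply: eq_bigr => i _; rewrite weight_prefix.
by rewrite weight_low ?scale0r // leq_addr /= -ltn_subRL.
Qed.

Lemma smooth_max_prefix : smooth_max m z = smooth_max k z'.
Proof.
rewrite /smooth_max (level_prefix jk km zz' low); congr (_ + _ / _).
rewrite -(level_prefix jk km zz' low) -(subnKC km) big_split_ord /= subnKC //.
rewrite [X in _ + X]big1 ?addr0 => [|i _].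
  by apply: eq_bigr => i _; rewrite zz'.
have /weight_low : (k <= k + i < m)%N by rewrite leq_addr /= -ltn_subRL.
move=> /eqP; rewrite /weight mulf_eq0 invr_eq0 (gt_eqF mu_gt0) orbF => /eqP ->.
by rewrite expr0n.
Qed.

End Prefix.
End SmoothMax.

(** * The hard function *)

Section HardFunction.
Variables (R : realType) (n : nat) (mu beta : R).
Hypotheses (mu_gt0 : 0 < mu) (beta_gt0 : 0 < beta).
Implicit Types (d : seq 'rV[R]_n) (x y : 'rV[R]_n) (a b l : nat -> R).

Definition orthonormal_seq d := forall i j, (i < size d)%N -> (j < size d)%N ->
  dot d`_i d`_j = (i == j)%:R.

Lemma dot_orthonormal d a j : orthonormal_seq d -> (j < size d)%N ->
  dot d`_j (\sum_(i < size d) a i *: d`_i) = a j.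
Proof.
move=> od jd; rewrite dot_sumr (bigD1 (Ordinal jd)) //= dotZr od // eqxx mulr1.
rewrite big1 ?addr0 // => i ij; rewrite dotZr od //.
by rewrite eq_sym (negPf (ij : nat_of_ord i != j)) mulr0.
Qed.

Lemma dot_orthonormal2 d a b : orthonormal_seq d ->
  dot (\sum_(i < size d) a i *: d`_i) (\sum_(i < size d) b i *: d`_i) =
  \sum_(i < size d) a i * b i.
Proof.
move=> od; rewrite dot_suml; apply: eq_bigr => i _.
by rewrite dotZl dot_orthonormal.
Qed.

(** The shift by [i mu] is what hides a piece behind an earlier one that it does
    not exceed before the shifts; see [oracle_prefix]. *)
Definition pieces d x i : R := dot d`_i x - i%:R * mu.

Definition hard d : 'rV[R]_n -> R^o :=
  fun x => beta * smooth_max mu (size d) (pieces d x).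

(** The gradient of [hard d] without its factor [beta]. *)
Definition slope d x : 'rV[R]_n :=
  \sum_(i < size d) weight mu (size d) (pieces d x) i *: d`_i.

Lemma hard_ge d x l : (0 < size d)%N -> (forall i, 0 <= l i) ->
  \sum_(i < size d) l i = 1 ->
  beta * (\sum_(i < size d) l i * pieces d x i
          - mu / 2 * \sum_(i < size d) l i ^+ 2) <= hard d x.
Proof.
move=> d0 l0 l1; rewrite ler_pM2l //.
apply: le_trans (smooth_max_ge mu_gt0 (pieces d x) d0 l0 l1).
rewrite lerDl mulr_ge0 ?divr_ge0 ?(ltW mu_gt0) // sumr_ge0 // => i _.
exact: sqr_ge0.
Qed.

Lemma hard_weight d x : (0 < size d)%N ->
  hard d x = beta *
    (\sum_(i < size d) weight mu (size d) (pieces d x) i * pieces d x i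
     - mu / 2 * \sum_(i < size d) weight mu (size d) (pieces d x) i ^+ 2).
Proof. by move=> d0; rewrite /hard smooth_max_weight. Qed.

Lemma sum_piecesB d x y l :
  \sum_(i < size d) l i * pieces d y i - \sum_(i < size d) l i * pieces d x i =
  dot (\sum_(i < size d) l i *: d`_i) (y - x).
Proof.
rewrite dot_suml -sumrB; apply: eq_bigr => i _.
by rewrite dotZl dotBr /pieces -mulrBr; congr (_ * _); ring.
Qed.

Lemma hard_subgradient d x y : (0 < size d)%N ->
  hard d x + beta * dot (slope d x) (y - x) <= hard d y.
Proof.
move=> d0; rewrite {1}hard_weight // -sum_piecesB -mulrDr.
have := @hard_ge d y (weight mu (size d) (pieces d x)) d0.
rewrite sum_weight // => /(_ (weight_ge0 mu_gt0 _ _) erefl).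
apply: le_trans; rewrite le_eqVlt; apply/orP; left; apply/eqP; ring.
Qed.

(** The strong concavity over the simplex of the quadratic defining
    [smooth_max] makes its maximizer a Lipschitz function of the data. *)
Lemma slope_cocoercive d x y : (0 < size d)%N -> orthonormal_seq d ->
  mu * enorm (slope d x - slope d y) ^+ 2 <=
  dot (slope d x - slope d y) (x - y).
Proof.
move=> d0 od; set k := size d.
set w := weight mu k (pieces d x); set w' := weight mu k (pieces d y).
have w0 := weight_ge0 mu_gt0 k (pieces d x).
have w0' := weight_ge0 mu_gt0 k (pieces d y).
have w1 := sum_weight mu_gt0 (pieces d x) d0.
have w1' := sum_weight mu_gt0 (pieces d y) d0.
have h := smooth_max_ge mu_gt0 (pieces d x) d0 w0' w1'.
have h' := smooth_max_ge mu_gt0 (pieces d y) d0 w0 w1.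
rewrite smooth_max_weight // in h; rewrite smooth_max_weight // in h'.
have ww : \sum_(i < k) (w' i - w i) ^+ 2 = \sum_(i < k) (w i - w' i) ^+ 2.
  by apply: eq_bigr => i _; ring.
pose v i := w i - w' i.
have -> : slope d x - slope d y = \sum_(i < k) v i *: d`_i.
  by rewrite -sumrB; apply: eq_bigr => i _; rewrite scalerBl.
rewrite sqr_enorm dot_orthonormal2 // -sum_piecesB {}/v.
under eq_bigr do rewrite -expr2.
under [X in _ <= X - _]eq_bigr do rewrite mulrBl.
under [X in _ <= _ - X]eq_bigr do rewrite mulrBl.
rewrite !sumrB; move: h h'; rewrite -/k -/w -/w' ww.
move: (\sum_(_ < _) _) => A; move: (\sum_(_ < _) _) => B.
move: (\sum_(_ < _) _) => C; move: (\sum_(_ < _) _) => D.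
move: (\sum_(_ < _) _) => E; move: (\sum_(_ < _) _) => G.
move: (\sum_(_ < _) _) => K.
lra.
Qed.

Lemma slope_lipschitz d x y : (0 < size d)%N -> orthonormal_seq d ->
  enorm (slope d x - slope d y) <= enorm (x - y) / mu.
Proof.
move=> d0 od; rewrite ler_pdivlMr //.
have [->|D0] := eqVneq (enorm (slope d x - slope d y)) 0.
  by rewrite mul0r enorm_ge0.
have Dp : 0 < enorm (slope d x - slope d y) by rewrite lt0r D0 enorm_ge0.
rewrite -(ler_pM2l Dp).
apply: le_trans (Cauchy_Schwarz _ _).
apply: le_trans (slope_cocoercive x y d0 od).
by rewrite expr2 [leRHS]mulrC mulrA.
Qed.

Lemma slope_diameter d x y : (0 < size d)%N -> orthonormal_seq d ->
  enorm (slope d x - slope d y) <= 2.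
Proof.
move=> d0 od.
suff slope1 z : enorm (slope d z) <= 1.
  have := enorm_triangle (slope d x) (- slope d y); rewrite enormN.
  by have := slope1 x; have := slope1 y; lra.
rewrite -(@ler_pXn2r _ 2) ?nnegrE ?enorm_ge0 // expr1n sqr_enorm.
rewrite dot_orthonormal2 // -(sum_weight mu_gt0 (pieces d z) d0).
by apply: ler_sum => i _; rewrite ler_piMr ?weight_ge0 ?weight_le1.
Qed.

(** The error of the linearization at [x] is between [0] and the change of the
    slope along the step, which is at most quadratic. *)
Lemma hard_gradient d x : (0 < size d)%N -> orthonormal_seq d ->
  differentiable (hard d) x /\ gradient (hard d) x = beta *: slope d x.
Proof.
move=> d0 od; apply: (@quadratic_gap_differential _ _ _ _ _ (beta / mu)) => h.
have h1 := hard_subgradient x (x + h) d0.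
have h2 := hard_subgradient (x + h) x d0.
have h3 : dot (slope d (x + h) - slope d x) h <= dot h h / mu.
  apply: le_trans (Cauchy_Schwarz _ _) _.
  have := slope_lipschitz (x + h) x d0 od.
  rewrite (addrC x h) addrK => h3; rewrite -sqr_enorm expr2 mulrAC.
  by rewrite ler_wpM2r ?enorm_ge0.
rewrite (_ : x + h - x = h) in h1; last by rewrite (addrC x h) addrK.
rewrite (_ : x - (x + h) = - h) in h2; last by rewrite opprD addrA subrr sub0r.
rewrite dotNr in h2; rewrite dotBl in h3.
rewrite dotZl ger0_norm; last by lra.
rewrite mulrAC -mulrA.
have := ler_wpM2l (ltW beta_gt0) h3; rewrite mulrBr.
set u := dot h h / mu; lra.
Qed.

Lemma hard_convex d : (0 < size d)%N ->
  convex_function (E := 'rV[R]_n) setT (hard d).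
Proof.
move=> d0 t x y _ _.
have c0 : 0 <= t%:num by exact: ge0.
have c1 : 0 <= 1 - t%:num by rewrite subr_ge0; exact: le1.
rewrite convRE; set z := conv t x y; set c := t%:num in c0 c1 *.
rewrite -[leRHS]/(c * hard d x + (1 - c) * hard d y).
have -> : c * hard d x + (1 - c) * hard d y =
  hard d z + (c * (hard d x - hard d z) + (1 - c) * (hard d y - hard d z)).
  by ring.
have hx := hard_subgradient z x d0; have hy := hard_subgradient z y d0.
rewrite lerDl.
have : 0 <= c * (beta * dot (slope d z) (x - z))
          + (1 - c) * (beta * dot (slope d z) (y - z)).
  have zE : z = c *: x + (1 - c) *: y by [].
  rewrite mulrCA [X in _ + X]mulrCA -mulrDr -!dotZr -dotDr.
  rewrite (_ : c *: (x - z) + _ = 0) ?dot0r ?mulr0 //.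
  by rewrite !scalerBr addrACA -zE -opprD -scalerDl subrKC scale1r subrr.
move/le_trans; apply; apply: lerD; apply: ler_wpM2l => //; lra.
Qed.

Lemma hard_midpoint d x y : (0 < size d)%N ->
  hard d (2^-1 *: (x + y)) <= (hard d x + hard d y) / 2.
Proof.
move=> d0; set z := 2^-1 *: (x + y).
have := hard_subgradient z x d0.
have := hard_subgradient z y d0.
have : dot (slope d z) (x - z) + dot (slope d z) (y - z) = 0.
  rewrite -dotDr (_ : _ + _ = 0) ?dot0r //.
  by apply/rowP => i; rewrite !mxE; field.
nra.
Qed.

(** With [D] the variation of the slope and [e] that of the point, both [D <= 2]
    and [D <= e / mu] hold, whence [D <= 2^(1 - nu) (e / mu)^nu]. *)
Lemma hard_holder d nu H : (0 < size d)%N -> orthonormal_seq d ->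
  0 <= nu -> nu <= 1 -> beta = 1 / 2 * H * mu `^ nu ->
  holder_gradient nu H (hard d).
Proof.
move=> d0 od nu0 nu1 bE x y.
have [_ ->] := hard_gradient x d0 od; have [_ ->] := hard_gradient y d0 od.
rewrite -scalerBr enormZ gtr0_norm //.
have H0 : 0 <= H.
  have := beta_gt0; rewrite bE pmulr_lgt0 ?powR_gt0 // pmulr_rgt0 ?divr_gt0 //.
  exact: ltW.
have e0 := enorm_ge0 (x - y).
have := slope_diameter x y d0 od; have := slope_lipschitz x y d0 od.
move: (enorm (slope d x - slope d y)) (enorm_ge0 (slope d x - slope d y)).
move=> D D0 De D2.
have DE : D <= 2 * (enorm (x - y) / mu) `^ nu.
  have [->|Dn] := eqVneq D 0; first by rewrite mulr_ge0 ?powR_ge0.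
  have -> : D = D `^ (1 - nu) * D `^ nu.
    by rewrite -powRD ?subrK ?powRr1 // Dn implybT.
  apply: ler_pM; rewrite ?powR_ge0 //.
    apply: (@le_trans _ _ (2 `^ (1 - nu))).
      by apply: ge0_ler_powR; rewrite ?nnegrE // subr_ge0.
    by rewrite ler1_powR ?ler1n // gerBl.
  by apply: ge0_ler_powR; rewrite ?nnegrE ?divr_ge0 // ltW.
have eE : enorm (x - y) `^ nu = mu `^ nu * (enorm (x - y) / mu) `^ nu.
  rewrite -powRM ?divr_ge0 ?(ltW mu_gt0) //.
  by rewrite mulrCA divff ?gt_eqF // mulr1.
rewrite eE bE; apply: le_trans (ler_wpM2l _ DE) _.
  by rewrite !mulr_ge0 ?powR_ge0.
by rewrite le_eqVlt; apply/orP; left; apply/eqP; field.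
Qed.

(** If at [x] the piece [j] beats all pieces from [k] on before the shifts are
    subtracted, then after subtraction it beats them by [mu], and the oracle
    cannot see them. *)
Lemma oracle_prefix d k j x : orthonormal_seq d -> (j < k <= size d)%N ->
  (forall i, (k <= i < size d)%N -> dot d`_i x <= dot d`_j x) ->
  oracle (hard d) x = oracle (hard (take k d)) x.
Proof.
move=> od /andP[jk kd] dom.
have sk : size (take k d) = k by rewrite size_takel.
have k0 : (0 < k)%N by apply: leq_ltn_trans jk.
have d0 : (0 < size d)%N by apply: leq_trans kd.
have ok : orthonormal_seq (take k d).
  move=> i l; rewrite sk => ik lk; rewrite !nth_take //.
  by apply: od; exact: leq_trans kd.
have same i : (i < k)%N -> pieces d x i = pieces (take k d) x i.
  by move=> ik; rewrite /pieces nth_take.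
have low i : (k <= i < size d)%N -> pieces d x i <= pieces d x j - mu.
  move=> id; rewrite /pieces.
  have ji : j.+1%:R * mu <= i%:R * mu.
    rewrite ler_wpM2r ?ler_nat ?ltW //; case/andP: id => ki _.
    exact: leq_trans ki.
  have := dom i id; move: ji; rewrite -natr1 mulrDl mul1r; lra.
rewrite /oracle; congr pair.
  by rewrite /hard sk (smooth_max_prefix mu_gt0 jk kd same low).
have [_ ->] := hard_gradient x d0 od.
have [|_ ->] := hard_gradient x _ ok; first by rewrite sk.
rewrite /slope sk (sum_weight_prefix mu_gt0 jk kd same low); congr (_ *: _).
by apply: eq_bigr => i _; rewrite nth_take.
Qed.

End HardFunction.

(** * The resisting oracle *)

Section Resisting.
Variables (R : realType) (n : nat) (mu beta : R).
Hypotheses (mu_gt0 : 0 < mu) (beta_gt0 : 0 < beta).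
Variable A : algorithm R n.
Implicit Types d : seq 'rV[R]_n.

(** The point that the algorithm asks for after [k] answers about [hard d]. *)
Definition query d k : 'rV[R]_n := A (transcript A (hard mu beta d) k).

(** The point in question is computed without [d`_j] and its successors, so that
    these can be chosen after it.  The domination hides the later directions;
    the sign condition keeps the final value from being small. *)
Definition resisting d := forall j, (j < size d)%N ->
  0 <= dot d`_j (query (take j d) j) /\
  forall i, (j <= i < size d)%N ->
    dot d`_i (query (take j d) j) <= dot d`_j (query (take j d) j).

(** By induction the query is the same for both functions; there the direction
    of index [k] hides all later ones, so the next answer is the same too. *)
Lemma transcript_take d k m : orthonormal_seq d -> resisting d ->
  (k <= m <= size d)%N ->
  transcript A (hard mu beta (take m d)) k =
  transcript A (hard mu beta (take k d)) k.
Proof.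
move=> od rd; elim: k m => [//|k IH] m /andP[km md].
have kd : (k < size d)%N by apply: leq_trans md.
rewrite /= (IH m) ?(ltnW km) // (IH k.+1) ?leqnSn //.
have otake l : (l <= size d)%N -> orthonormal_seq (take l d).
  move=> ld i j; rewrite size_takel // => il jl; rewrite !nth_take //.
  by apply: od; exact: leq_trans ld.
have [_ dom] := rd k kd.
have see : oracle (hard mu beta (take m d)) (query (take k d) k) =
           oracle (hard mu beta (take k.+1 d)) (query (take k d) k).
  rewrite -[take k.+1 d](take_takel d km).
  apply: (oracle_prefix mu_gt0 beta_gt0 (j := k)) => [||i].
  - exact: otake.
  - by rewrite ltnSn size_takel.
  - rewrite size_takel // => /andP[ki im]; rewrite !nth_take //.
    by apply: dom; rewrite (ltnW ki) (leq_trans im).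
by apply/val_inj; rewrite /= -/(query (take k d) k) see.
Qed.

Lemma iterate_take d k : orthonormal_seq d -> resisting d -> (k < size d)%N ->
  iterate A (hard mu beta d) k.+1 = query (take k d) k.
Proof.
move=> od rd kd; rewrite /iterate /query /= -(transcript_take (m := size d)) //.
  by rewrite take_size.
by rewrite leqnn ltnW.
Qed.

Definition signed_basis (q : 'I_n * bool) : 'rV[R]_n :=
  (-1) ^+ q.2 *: delta_mx 0 q.1.

Lemma dot_signed_basis q x : dot (signed_basis q) x = (-1) ^+ q.2 * x 0 q.1.
Proof. by rewrite dotZl dot_delta. Qed.

Lemma orthonormal_signed_basis (p : seq ('I_n * bool)) :
  uniq (unzip1 p) -> orthonormal_seq (map signed_basis p).
Proof.
move=> up i j; rewrite size_map => ip jp.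
have [q0 _] : exists q, q \in p.
  by case: p ip {up jp} => // q p' _; exists q; rewrite inE eqxx.
rewrite !(nth_map q0) // dot_signed_basis !mxE eqxx /=.
have [<-|ij] := eqVneq i j; first by rewrite eqxx mulr1 -expr2 sqrr_sign.
have := nth_uniq q0.1 _ _ up (i := i) (j := j).
rewrite !size_map => /(_ ip jp); rewrite !(nth_map q0) // => ->.
by rewrite (negPf ij) !mulr0.
Qed.

(** Each new direction is the unused signed coordinate that is largest at the
    next query; being largest among the unused coordinates, it also dominates
    the directions that will be chosen afterwards. *)
Lemma resisting_directions T : (T <= n)%N ->
  exists d, [/\ size d = T, orthonormal_seq d & resisting d].
Proof.
move=> Tn; suff [p [sp up rp]] : exists p : seq ('I_n * bool),
    [/\ size p = T, uniq (unzip1 p) & forall j, (j < T)%N ->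
      let d := map signed_basis p in
      forall i, i \notin take j (unzip1 p) ->
      `|query (take j d) j 0 i| <= dot d`_j (query (take j d) j)].
  exists (map signed_basis p); split; first by rewrite size_map.
    exact: orthonormal_signed_basis.
  have later j i : (j <= i < T)%N ->
      exists2 q, (map signed_basis p)`_i = signed_basis q &
                 q.1 \notin take j (unzip1 p).
    case/andP=> ji iT; have ip : (i < size p)%N by rewrite sp.
    have [q0 _] : exists q, q \in p.
      by case: p ip {sp up rp} => // q p' _; exists q; rewrite inE eqxx.
    exists (nth q0 p i); first by rewrite (nth_map q0).
    rewrite -(nth_map _ q0.1) // in_take ?mem_nth ?size_map //.
    by rewrite index_uniq ?size_map // -leqNgt.
  move=> j; rewrite size_map sp => jT; split=> [|i ijT].
    have [|q _ /(rp j jT)] := later j j; first by rewrite leqnn.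
    exact: le_trans.
  have [q -> /(rp j jT)] := later j i ijT; apply: le_trans.
  rewrite dot_signed_basis; apply: le_trans (ler_norm _) _.
  by rewrite normrM normrX normrN1 expr1n mul1r.
elim: T Tn => [_|T IH Tn]; first by exists [::].
have [p [sp up rp]] := IH (ltnW Tn).
pose x := query (map signed_basis p) T.
have [l lp lmax] : exists2 l, l \notin unzip1 p &
    forall i, i \notin unzip1 p -> `|x 0 i| <= `|x 0 l|.
  have [l0 l0p] : exists l, l \notin unzip1 p.
    apply/existsP; apply: contraT => /existsPn allp.
    have : (#|'I_n| <= size (unzip1 p))%N.
      apply: leq_trans (card_size _); apply: subset_leq_card.
      by apply/fintype.subsetP => i _; rewrite -[_ \in _]negbK allp.
    by rewrite card_ord size_map sp leqNgt Tn.
  pose unused := [pred l | l \notin unzip1 p].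
  case: (@arg_maxP _ R _ l0 unused (fun i => `|x 0 i|) l0p)
    => l lp lmax.
  by exists l.
exists (rcons p (l, x 0 l < 0)); split; first by rewrite size_rcons sp.
  by rewrite /unzip1 map_rcons rcons_uniq lp.
move=> j; rewrite ltnS leq_eqVlt /unzip1 !map_rcons => /predU1P[->|jT] i /=.
  rewrite -!cats1 !takel_cat ?size_map ?sp // !take_oversize ?size_map ?sp //.
  move=> /lmax; rewrite -/x nth_cat size_map sp ltnn subnn /= => lmx.
  apply: le_trans lmx _; rewrite dot_signed_basis /=.
  by rewrite normrEsign.
rewrite -!cats1 !takel_cat ?size_map ?sp ?(ltnW jT) // => /(rp j jT).
by rewrite nth_cat size_map sp jT.
Qed.

End Resisting.

(** * Values of the hard function *)

Section Values.
Variables (R : realType) (n : nat) (mu beta : R).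
Hypotheses (mu_gt0 : 0 < mu) (beta_gt0 : 0 < beta).
Variable d : seq 'rV[R]_n.
Hypotheses (d0 : (0 < size d)%N) (od : orthonormal_seq d).
Implicit Types x y : 'rV[R]_n.

Let T : R := (size d)%:R.
Let T_gt0 : 0 < T. Proof. by rewrite ltr0n. Qed.

Definition mean_shift : R := (\sum_(i < size d) i%:R * mu) / T.

(** The lower bound [hard_ge] with all the weight on the last piece. *)
Lemma hard_ge_last x : 0 <= dot d`_(size d).-1 x ->
  - (beta * (T * mu)) <= hard mu beta d x.
Proof.
move=> dx; pose l i : R := (i == (size d).-1)%:R.
have pd : ((size d).-1 < size d)%N by rewrite prednK.
have sl (F : nat -> R) : \sum_(i < size d) l i * F i = F (size d).-1.
  rewrite (bigD1 (Ordinal pd)) //= /l eqxx mul1r big1 ?addr0 // => i.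
  by rewrite -val_eqE /= => /negPf ->; rewrite mul0r.
have := @hard_ge _ _ _ _ mu_gt0 beta_gt0 d x l d0 (fun i => ler0n _ _).
have -> : \sum_(i < size d) l i = 1.
  by rewrite -(sl (fun _ => 1)); apply: eq_bigr => i _; rewrite mulr1.
have -> : \sum_(i < size d) l i ^+ 2 = 1.
  rewrite -(sl (fun _ => 1)); apply: eq_bigr => i _.
  by rewrite mulr1 /l; case: (_ == _); rewrite ?expr1n ?expr0n.
rewrite sl => /(_ erefl); apply: le_trans.
rewrite -mulrN ler_pM2l // /pieces.
have -> : T = (size d).-1%:R + 1 by rewrite natr1 prednK.
move: (dot _ _) dx => c dx; have := mu_gt0; nra.
Qed.

(** The lower bound [hard_ge] with uniform weights; the mean of orthonormal
    vectors has norm [1 / sqrt T]. *)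
Lemma hard_ge_mean x :
  beta * (- (enorm x / Num.sqrt T) - mean_shift - mu / (2 * T)) <=
  hard mu beta d x.
Proof.
have T0 : T != 0 by rewrite gt_eqF.
have l1 : \sum_(i < size d) T^-1 = 1 :> R.
  by rewrite sumr_const card_ord -mulr_natl divff.
have Ti0 (i : nat) : 0 <= T^-1 by rewrite invr_ge0 ltW.
have := hard_ge mu_gt0 beta_gt0 x d0 Ti0 l1.
apply: le_trans; rewrite ler_pM2l //.
have -> : \sum_(i < size d) T^-1 ^+ 2 = T^-1.
  under eq_bigr do rewrite expr2.
  by rewrite -mulr_suml l1 mul1r.
have -> : \sum_(i < size d) T^-1 * pieces mu d x i =
    dot (\sum_(i < size d) T^-1 *: d`_i) x - mean_shift.
  rewrite dot_suml /mean_shift mulr_suml -sumrB; apply: eq_bigr => i _.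
  by rewrite dotZl /pieces mulrBr (mulrC _ T^-1).
have -> : mu / 2 * T^-1 = mu / (2 * T) by field.
rewrite lerB // lerB // lerNl -dotNr; apply: le_trans (Cauchy_Schwarz _ _) _.
rewrite enormN mulrC ler_wpM2l ?enorm_ge0 // enormE.
rewrite (dot_orthonormal2 (fun _ => T^-1) (fun _ => T^-1) od).
by rewrite -mulr_suml l1 mul1r sqrtrV // ltW.
Qed.

(** Weights with sum [1] have a sum of squares of at least [1 / T], and that is
    the term by which the smoothed maximum stays below the maximum. *)
Lemma hard_le y c : (forall i, (i < size d)%N -> pieces mu d y i <= c) ->
  hard mu beta d y <= beta * (c - mu / (2 * T)).
Proof.
move=> yc; rewrite (hard_weight beta mu_gt0) // ler_pM2l //.
set w := weight _ _ _; have w1 := sum_weight mu_gt0 (pieces mu d y) d0.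
have T0 : T != 0 by rewrite gt_eqF.
apply: lerB.
  apply: (@le_trans _ _ (\sum_(i < size d) w i * c)).
    by apply: ler_sum => i _; rewrite ler_wpM2l ?yc // weight_ge0.
  by rewrite -mulr_suml w1 mul1r.
have : 0 <= \sum_(i < size d) (w i - T^-1) ^+ 2.
  by apply: sumr_ge0 => i _; apply: sqr_ge0.
have -> : \sum_(i < size d) (w i - T^-1) ^+ 2 =
          \sum_(i < size d) w i ^+ 2 - T^-1.
  have invE : T^-1 = \sum_(i < size d) (2 * w i / T - T^-1 ^+ 2).
    rewrite sumrB -mulr_suml -mulr_sumr w1 sumr_const card_ord -mulr_natl -/T.
    by field.
  by rewrite [X in _ = _ - X]invE -sumrB; apply: eq_bigr => i _; field.
rewrite subr_ge0 => h; have -> : mu / (2 * T) = mu / 2 * T^-1 by field.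
by rewrite ler_wpM2l // divr_ge0 // ltW.
Qed.

Lemma hard_le_diagonal t :
  hard mu beta d (\sum_(i < size d) (- t) *: d`_i) <= - (beta * t).
Proof.
apply: le_trans (_ : beta * (- t - mu / (2 * T)) <= _).
  apply: hard_le => i id; rewrite /pieces.
  rewrite (dot_orthonormal (fun _ => - t)) // gerBl.
  by rewrite mulr_ge0 // ltW.
by rewrite -[leRHS]mulrN ler_pM2l // gerBl divr_ge0 ?mulr_ge0 ?(ltW mu_gt0) //.
Qed.

Lemma enorm_diagonal t : 0 <= t ->
  enorm (\sum_(i < size d) (- t) *: d`_i) = t * Num.sqrt T.
Proof.
move=> t0; rewrite enormE (dot_orthonormal2 (fun _ => - t) (fun _ => - t)) //.
rewrite sumr_const card_ord -mulr_natl -/T mulrNN mulrC -expr2.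
by rewrite sqrtrM ?sqr_ge0 // sqrtr_sqr ger0_norm.
Qed.

(** At this point all pieces are equal, so that [hard_ge_mean] is nearly sharp;
    the diagonal point would leave a gap of order [mu * size d], too large for
    the bound on the norm of the solution. *)
Definition level_point t : 'rV[R]_n :=
  \sum_(i < size d) (i%:R * mu - mean_shift - t) *: d`_i.

Lemma hard_le_level_point t :
  hard mu beta d (level_point t) <=
  beta * (- t - mean_shift - mu / (2 * T)).
Proof.
apply: hard_le => i id; rewrite /pieces /level_point.
rewrite (dot_orthonormal (fun i => i%:R * mu - mean_shift - t)) //.
by rewrite le_eqVlt; apply/orP; left; apply/eqP; ring.
Qed.

Lemma sqr_enorm_level_point t :
  enorm (level_point t) ^+ 2 <= T * (t ^+ 2 + (T * mu) ^+ 2).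
Proof.
have T0 : T != 0 by rewrite gt_eqF.
pose b i : R := i%:R * mu - mean_shift.
have b0 : \sum_(i < size d) b i = 0.
  rewrite sumrB sumr_const card_ord -mulr_natl -/T /mean_shift mulrC.
  by rewrite divfK // subrr.
have m0 : 0 <= mean_shift.
  rewrite divr_ge0 ?(ltW T_gt0) // sumr_ge0 // => i _.
  by rewrite mulr_ge0 // ltW.
have mT : mean_shift <= T * mu.
  rewrite ler_pdivrMr // mulrC -/T mulr_natl -[in leRHS](card_ord (size d)).
  rewrite -sumr_const; apply: ler_sum => i _.
  by rewrite ler_wpM2r ?(ltW mu_gt0) // ler_nat ltnW.
rewrite sqr_enorm /level_point.
rewrite (dot_orthonormal2 (fun i => b i - t) (fun i => b i - t)) //.
have -> : \sum_(i < size d) (b i - t) * (b i - t) =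
    \sum_(i < size d) (b i ^+ 2 + t ^+ 2) - 2 * t * \sum_(i < size d) b i.
  by rewrite mulr_sumr -sumrB; apply: eq_bigr => i _; ring.
rewrite b0 mulr0 subr0.
apply: (@le_trans _ _ (\sum_(i < size d) (t ^+ 2 + (T * mu) ^+ 2))).
  apply: ler_sum => i _; rewrite addrC lerD2l.
  have Tmu0 : 0 <= T * mu by rewrite mulr_ge0 // ltW.
  rewrite -real_normK ?num_real // ler_pXn2r ?nnegrE ?normr_ge0 //.
  have i0 : 0 <= i%:R * mu by rewrite mulr_ge0 // ltW.
  have iT : i%:R * mu <= T * mu.
    by rewrite ler_wpM2r ?(ltW mu_gt0) // ler_nat ltnW.
  by rewrite ler_norml /b; apply/andP; split; lra.
by rewrite sumr_const card_ord -mulr_natl.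
Qed.

End Values.

(** * Choice of the parameters *)

Section Balance.
Variables (R : realType) (p sigma nu H tau : R).
Hypotheses (p_ge2 : 2 <= p) (sigma_gt0 : 0 < sigma) (nu_ltp1 : nu < p - 1)
  (H_gt0 : 0 < H) (tau_gt0 : 0 < tau).

Let p1_gt0 : 0 < p - 1. Proof. by move: p_ge2; lra. Qed.
Let p_gt0 : 0 < p. Proof. by move: p_ge2; lra. Qed.
Let q_gt0 : 0 < p - 1 - nu. Proof. by rewrite subr_gt0. Qed.

(** The norm at which the unsmoothed and unshifted problem has its minimizer. *)
Definition solution_scale : R :=
  (1 / 2 * ((p - 1) / (4 * p)) `^ nu) `^ (1 / (p - 1 - nu)) *
  (H / (sigma * tau `^ ((1 + 3 * nu) / 2))) `^ (1 / (p - 1 - nu)).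

Definition smoothing : R :=
  (p - 1) / (4 * p) * (solution_scale / (Num.sqrt tau * tau)).

Definition amplitude : R := 1 / 2 * H * smoothing `^ nu.

Ltac positivity := repeat first
  [ assumption | exact: ltr01 | exact: ltr0n | apply: mulr_gt0 | apply: powR_gt0
  | rewrite invr_gt0 | rewrite sqrtr_gt0 | by rewrite ltr0n ].

Ltac expand_ln := repeat first
  [ rewrite ln_powR | rewrite lnM ?posrE; [|positivity..]
  | rewrite lnV ?posrE; [|positivity..] | rewrite ln1 ].

Lemma solution_scale_gt0 : 0 < solution_scale.
Proof. rewrite /solution_scale; positivity. Qed.

Lemma smoothing_gt0 : 0 < smoothing.
Proof. have r0 := solution_scale_gt0; rewrite /smoothing; positivity. Qed.

Lemma amplitude_gt0 : 0 < amplitude.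
Proof. have s0 := smoothing_gt0; rewrite /amplitude; positivity. Qed.

Lemma ln4 : ln (4 : R) = 2 * ln 2.
Proof.
have -> : 4 = 2 * 2 :> R by rewrite -natrM.
by rewrite lnM ?posrE ?ltr0n // mulr_natl.
Qed.

(** The optimality condition for the scale: the power term and the slope
    [amplitude / sqrt tau] of the hard function along the diagonal balance. *)
Lemma amplitudeE : amplitude = sigma * solution_scale `^ (p - 1) * Num.sqrt tau.
Proof.
have r0 := solution_scale_gt0; have s0 := smoothing_gt0.
have a0 := amplitude_gt0.
apply: ln_inj; rewrite ?posrE //; first by positivity.
rewrite /amplitude /smoothing /solution_scale -powR12_sqrt ?ltW //.
by expand_ln; rewrite ln4; field; rewrite !gt_eqF.
Qed.

(** Both sides are products of powers of [p - 1], [p], [2], [H], [sigma] and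
    [tau]; their logarithms are compared. *)
Lemma residual_constantE :
  ((p - 1) / p) `^ ((p - 1) * (1 + nu) / (p - 1 - nu)) *
  (1 / 2) `^ ((2 * p - 1) * (1 + nu) / (p - 1 - nu)) *
  (H / (sigma `^ ((1 + nu) / p) * tau `^ ((1 + 3 * nu) / 2)))
    `^ (p / (p - 1 - nu)) =
  sigma * solution_scale `^ p * ((p - 1) / p / 2).
Proof.
have r0 := solution_scale_gt0.
apply: ln_inj; rewrite ?posrE; [positivity..|].
rewrite /solution_scale.
expand_ln; rewrite ln4; field; by rewrite !gt_eqF.
Qed.

End Balance.

(** * The lower bound *)

Theorem theorem4 (R : realType) (n : nat) (p sigma nu H : R) (T : nat)
    (n_ge1 : (1 <= n)%N) (p_ge2 : 2 <= p) (sigma_gt0 : 0 < sigma)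
    (nu_ge0 : 0 <= nu) (nu_le1 : nu <= 1) (nu_ltp1 : nu < p - 1)
    (H_gt0 : 0 < H) (T_ge1 : (1 <= T)%N) (T_len : (T <= n)%N)
    (A : algorithm R n) :
  exists f : 'rV[R]_n -> R^o,
    [/\ convex_function (E := 'rV[R]_n) setT f,
        forall x : 'rV[R]_n, differentiable f x,
        holder_gradient nu H f &
        exists xstar : 'rV[R]_n,
          let F := regularized sigma p f in
          [/\ unique (minimizer F) xstar,
              F (iterate A f T) - F xstar >=
                ((p - 1) / p) `^ ((p - 1) * (1 + nu) / (p - 1 - nu)) *
                (1 / 2) `^ ((2 * p - 1) * (1 + nu) / (p - 1 - nu)) *
                (H / (sigma `^ ((1 + nu) / p) *
                      T%:R `^ ((1 + 3 * nu) / 2))) `^ (p / (p - 1 - nu)) &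
              enorm xstar <=
                (3 * (p - 1) * 2 `^ (p - 3)) `^ (1 / p) *
                (1 / 2 * ((p - 1) / (4 * p)) `^ nu) `^ (1 / (p - 1 - nu)) *
                (H / (sigma * T%:R `^ ((1 + 3 * nu) / 2)))
                  `^ (1 / (p - 1 - nu))]].
Proof.
have p_gt0 : 0 < p by lra.
have tau_gt0 : (0 : R) < T%:R by rewrite ltr0n.
set tau : R := T%:R in tau_gt0 *.
pose s := solution_scale p sigma nu H tau.
pose mu := smoothing p sigma nu H tau.
pose beta := amplitude p sigma nu H tau.
have s_gt0 : 0 < s by apply: solution_scale_gt0.
have mu_gt0 : 0 < mu by apply: smoothing_gt0.
have beta_gt0 : 0 < beta by apply: amplitude_gt0.
pose t := s / Num.sqrt tau.
have rtau_gt0 : 0 < Num.sqrt tau by rewrite sqrtr_gt0.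
have t_gt0 : 0 < t by rewrite divr_gt0.
have st : s = t * Num.sqrt tau by rewrite divfK // gt_eqF.
pose a := (p - 1) / p.
have ap : a * p = p - 1 by rewrite divfK // gt_eqF.
have a_ge0 : 0 <= a by rewrite divr_ge0 ?(ltW p_gt0) //; lra.
have a_le1 : a <= 1 by rewrite ler_pdivrMr //; lra.
have tau_mu : tau * mu = a / 4 * t.
  rewrite /mu /smoothing -/s /t /a; field.
  by rewrite !gt_eqF.
have beta_t : beta * t = sigma * s `^ p.
  rewrite /beta amplitudeE // -/s -(mulr_powRB1 (ltW s_gt0) p_gt0) {2}st.
  by ring.
have [d [sd od rd]] := resisting_directions mu beta A T_len.
have d0 : (0 < size d)%N by rewrite sd.
have dtau : (size d)%:R = tau by rewrite sd.
exists (hard mu beta d); split.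
- exact: hard_convex.
- by move=> x; have [] := hard_gradient mu_gt0 beta_gt0 x d0 od.
- exact: hard_holder.
(* The affine minorant is the tangent of the hard function at the origin. *)
have [x xm] : exists x,
    unique (minimizer (regularized sigma p (hard mu beta d))) x.
  apply: (@regularized_unique_minimizer _ _ _ _ _ (beta *: slope mu d 0)) => //.
  - move=> x; apply: differentiable_continuous.
    by have [] := hard_gradient mu_gt0 beta_gt0 x d0 od.
  - move=> x; rewrite dotZl -{1}[x]subr0.
    exact: hard_subgradient.
  - by move=> x y; apply: hard_midpoint.
exists x; move=> F; split=> //.
  rewrite residual_constantE // -/s -/a.
  have T1 : (T.-1 < size d)%N by rewrite sd prednK.
  have := iterate_take mu_gt0 beta_gt0 od rd T1; rewrite prednK // => ->.
  have [last _] := rd _ T1; rewrite -sd in last.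
  have Fx := hard_ge_last mu_gt0 beta_gt0 d0 last; rewrite sd in Fx.
  (* The diagonal point of norm s is optimal up to smoothing and shifts. *)
  have Fs := xm.1 (\sum_(i < size d) (- t) *: d`_i).
  have up := hard_le_diagonal mu_gt0 beta_gt0 d0 od t.
  rewrite /regularized (enorm_diagonal od (ltW t_gt0)) dtau -st in Fs.
  rewrite /F /regularized -/tau tau_mu in Fx *.
  set xT := query _ _ _ _ _ in Fx *.
  have pow0 : 0 <= sigma / p * enorm xT `^ p.
    by rewrite mulr_ge0 ?powR_ge0 // divr_ge0 // ltW.
  have sp : sigma / p * s `^ p = beta * t * (1 - a).
    by rewrite beta_t /a; field; rewrite gt_eqF.
  rewrite sp in Fs; rewrite -beta_t.
  have gap0 : 0 <= beta * t * a by apply: mulr_ge0 => //; apply/ltW/mulr_gt0.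
  have eE : beta * (a / 4 * t) = beta * t * a / 4 by ring.
  rewrite eE in Fx; rewrite mulrBr mulr1 in Fs; rewrite mulrA.
  by lra.
rewrite -mulrA -[X in _ * X]/s.
pose r := enorm x / s.
have r0 : 0 <= r by rewrite divr_ge0 ?enorm_ge0 // ltW.
have xr : enorm x = r * s by rewrite divfK // gt_eqF.
have rE : r = (r `^ p) `^ p^-1 by rewrite -powRrM divff ?gt_eqF // powRr1.
rewrite xr ler_pM2r // div1r [leLHS]rE.
have K0 : 0 <= 3 * (p - 1) * 2 `^ (p - 3).
  by apply: mulr_ge0; rewrite ?powR_ge0 //; lra.
apply: ge0_ler_powR; rewrite ?invr_ge0 ?nnegrE ?powR_ge0 ?(ltW p_gt0) //.
apply: (@radius_bound _ _ _ ((1 + a ^+ 2 / 16) `^ (p / 2))) => //; last first.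
  apply: le_trans (powR_half_sub1_le p_ge2 _) _.
    by apply/andP; split; nra.
  rewrite [leRHS]mulrAC ler_wpM2r ?powR_ge0 //.
  have -> : p / 2 * (a ^+ 2 / 16) = (p - 1) * a / 32 by rewrite -ap; field.
  by rewrite ler_wpM2r // ler_piMr //; lra.
(* Dividing the comparison with the level point by sigma s^p / p gives the
   hypothesis of radius_bound. *)
have Fx := xm.1 (level_point mu d t).
rewrite /regularized in Fx.
have lo := hard_ge_mean mu_gt0 beta_gt0 d0 od x.
have up := hard_le_level_point mu_gt0 beta_gt0 d0 od t.
have nrm := sqr_enorm_level_point mu_gt0 d0 od t.
rewrite dtau in lo up nrm.
have nrmp : enorm (level_point mu d t) `^ p <=
    s `^ p * (1 + a ^+ 2 / 16) `^ (p / 2).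
  have v0 : 0 <= 1 + a ^+ 2 / 16 by nra.
  rewrite (powR_sqr p (enorm_ge0 _)) (powR_sqr p (ltW s_gt0)).
  rewrite -powRM ?sqr_ge0 //.
  have m0 : 0 <= p / 2 by lra.
  apply: ge0_ler_powR; rewrite ?nnegrE ?sqr_ge0 //.
    by rewrite mulr_ge0 ?sqr_ge0.
  apply: le_trans nrm _; rewrite tau_mu [in leRHS]st [X in _ <= X * _]exprMn.
  rewrite sqr_sqrtr ?(ltW tau_gt0) //.
  by rewrite le_eqVlt; apply/orP; left; apply/eqP; field.
have lo' : - (sigma * s `^ p * r) -
    beta * (mean_shift mu d + mu / (2 * tau)) <= hard mu beta d x.
  apply: le_trans lo; rewrite -beta_t xr st.
  rewrite le_eqVlt; apply/orP; left; apply/eqP; field.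
  by rewrite !gt_eqF.
have up' : hard mu beta d (level_point mu d t) <=
    - (sigma * s `^ p) - beta * (mean_shift mu d + mu / (2 * tau)).
  apply: le_trans up _; rewrite -beta_t.
  by rewrite le_eqVlt; apply/orP; left; apply/eqP; ring.
have sp0 : 0 < sigma * s `^ p / p by rewrite divr_gt0 // mulr_gt0 ?powR_gt0.
rewrite -(ler_pM2l sp0).
have xp : enorm x `^ p = r `^ p * s `^ p by rewrite xr powRM // ltW.
rewrite xp in Fx.
have sg : 0 <= sigma / p by rewrite divr_ge0 // ltW.
have nrms := ler_wpM2l sg nrmp.
have -> : sigma * s `^ p / p * (r `^ p - p * r) =
    sigma / p * (r `^ p * s `^ p) - sigma * s `^ p * r.
  by field; rewrite gt_eqF.
have -> : sigma * s `^ p / p * ((1 + a ^+ 2 / 16) `^ (p / 2) - p) =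
    sigma / p * (s `^ p * (1 + a ^+ 2 / 16) `^ (p / 2)) - sigma * s `^ p.
  by field; rewrite gt_eqF.
lra.
Qed.
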